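(* Let $m>1$ and let $\mathfrak{g}$ be the free nilpotent real Lie algebra of step two on $m$ generators $Z_1,\dots,Z_m$. Let $\ell\in\mathfrak{g}^*$ be a linear functional such that $\det M_0(\ell_k)\neq 0$ for every even $k$ with $2\le k\le m$. Let $\mathfrak{p}(\ell)$ be the Vergne polarizing subalgebra subordinated to $\ell$. If $m$ is odd, $m=2s+1$ for some natural number $s$, then $$\mathfrak{p}(\ell)=\mathfrak{z}(\mathfrak{g})+\mathbb{R}Z_1+\sum_{k=1}^{s}\mathbb{R}\Bigl(Z_{2k+1}-\mu_{2k}\bigl(M_0(\ell_{2k})^{-1}v(\ell_{2k+1})\bigr)\Bigr).$$ If $m$ is even, $m=2s$ for some natural number $s$, then $$\mathfrak{p}(\ell)=\mathfrak{z}(\mathfrak{g})+\mathbb{R}Z_1+\sum_{k=1}^{s-1}\mathbb{R}\Bigl(Z_{2k+1}-\mu_{2k}\bigl(M_0(\ell_{2k})^{-1}v(\ell_{2k+1})\bigr)\Bigr).$$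
   Context: The free nilpotent Lie algebra of step two on $m$ generators has basis $\{Z_{ik}:1\le i<k\le m\}\cup\{Z_1,\dots,Z_m\}$ with non-trivial brackets $[Z_i,Z_k]=Z_{ik}$ for $1\le i<k\le m$; its center is $\mathfrak{z}(\mathfrak{g})=\mathbb{R}\text{-span}\{Z_{ik}:1\le i<k\le m\}$, of dimension $m(m-1)/2$. One uses the ordered basis (a strong Malcev basis) consisting of the $Z_{ik}$ in some order followed by $Z_1,\dots,Z_m$. Given an ordered basis $W_1,\dots,W_n$ of this kind, put $\mathfrak{g}_{(j)}=\mathbb{R}\text{-span}\{W_1,\dots,W_j\}$ (an ideal) and let $\mathfrak{r}_{(j)}(\ell)=\{Y\in\mathfrak{g}_{(j)}:\ell([X,Y])=0\text{ for all }X\in\mathfrak{g}_{(j)}\}$; the Vergne polarizing subalgebra subordinated to $\ell$ is by definition $\mathfrak{p}(\ell)=\sum_{j=1}^{n}\mathfrak{r}_{(j)}(\ell)$, where $n=\dim\mathfrak{g}=m(m-1)/2+m$. For $1\le j\le m$, $M_0(\ell_j)$ denotes the $j\times j$ skew-symmetric matrix with $(a,b)$ entry $\ell([Z_a,Z_b])$, $1\le a,b\le j$; for $2\le j\le m$, $v(\ell_j)\in\mathbb{R}^{j-1}$ is the column vector $(\ell([Z_1,Z_j]),\dots,\ell([Z_{j-1},Z_j]))^t$. For $1\le k\le m$, $\mu_k:\mathbb{R}^k\to\mathfrak{g}$ is the linear map $\mu_k((z_1,\dots,z_k)^t)=z_1Z_1+\cdots+z_kZ_k$. *)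

(* Defs.v *)
From HB Require Import structures.
From mathcomp Require Import all_boot all_order all_algebra.

Set Implicit Arguments.
Unset Strict Implicit.
Unset Printing Implicit Defensive.

Import GRing.Theory.
Local Open Scope ring_scope.

HB.mixin Record Vector_isLieAlgebra (K : fieldType) g of Vector K g := {
  lie : g -> g -> g;
  lie_linearl : forall y, linear (fun x => lie x y);
  lie_linearr : forall x, linear (fun y => lie x y);
  liexx : forall x, lie x x = 0;
  lie_jacobi : forall x y z,
    lie x (lie y z) + lie y (lie z x) + lie z (lie x y) = 0
}.

#[short(type="lieAlgType")]
HB.structure Definition LieAlgebra (K : fieldType) :=
  { g of Vector_isLieAlgebra K g & Vector K g }.

HB.instance Definition _ (K : fieldType) (g : lieAlgType K) (x : g) :=
  GRing.isLinear.Build K g g _ (lie x) (lie_linearr x).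

Section LieSubspaces.
Variables (K : fieldType) (g : lieAlgType K).
Implicit Types (ell : 'Hom(g, K^o)) (h : {vspace g}) (W : seq g).

Definition lie_center : {vspace g} :=
  lker (linfun (fun x : g => linfun (fun y : g => lie x y))).

Lemma lie_centerP x : reflect (forall y, lie x y = 0) (x \in lie_center).
Proof.
pose f (x : g) := linfun (fun y : g => lie x y).
have fE u v : f u v = lie u v by rewrite lfunE.
have flin : linear f.
  move=> a u v; apply/lfunP=> y.
  by rewrite add_lfunE scale_lfunE !fE lie_linearl.
pose fL := GRing.isLinear.Build K g _ _ f flin.
pose F : {linear g -> 'Hom(g, g)} := HB.pack f fL.
have -> : (x \in lie_center) = (f x == 0).
  by rewrite memv_ker -[linfun _]/(linfun F) lfunE.
apply: (iffP eqP) => [fx0 y | x0]; first by rewrite -fE fx0 lfunE.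
by apply/lfunP=> y; rewrite fE x0 lfunE.
Qed.

(* The radical of the restriction to h of the form (x, y) |-> ell [x, y];      *)
(* see radicalP.                                                               *)
Definition radical ell h : {vspace g} :=
  (h :&: lker (linfun (fun y : g =>
     linfun (fun x : subvs_of h => ell (lie (vsval x) y) : K^o))))%VS.

Lemma radicalP ell h y :
  reflect (y \in h /\ forall x, x \in h -> ell (lie x y) = 0)
          (y \in radical ell h).
Proof.
have glin (y' : g) : linear (fun x : subvs_of h => ell (lie (vsval x) y') : K^o).
  by move=> a u v; rewrite linearP lie_linearl linearP.
pose f (y : g) := linfun (fun x : subvs_of h => ell (lie (vsval x) y) : K^o).
have fE u x : f u x = ell (lie (vsval x) u).
  pose gL := GRing.isLinear.Build K _ _ _ _ (glin u).
  pose G : {linear subvs_of h -> K^o} :=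
    HB.pack (fun x : subvs_of h => ell (lie (vsval x) u) : K^o) gL.
  by rewrite /f -[linfun _]/(linfun G) lfunE.
have flin : linear f.
  move=> a u v; apply/lfunP=> x.
  by rewrite add_lfunE scale_lfunE !fE !linearP.
pose fL := GRing.isLinear.Build K g _ _ f flin.
pose F : {linear g -> 'Hom(subvs_of h, K^o)} := HB.pack f fL.
have -> : (y \in radical ell h) = (y \in h) && (f y == 0).
  by rewrite memv_cap memv_ker -[linfun _]/(linfun F) lfunE.
apply: (iffP andP) => [[hy /eqP fy0] | [hy y0]]; split=> //.
  by move=> x hx; rewrite -[x](vsprojK hx) -fE fy0 lfunE.
by apply/eqP/lfunP=> x; rewrite fE y0 ?subvsP // lfunE.
Qed.

(* With W = [:: W_1; ...; W_n], <<take j W>> is the span of W_1, ..., W_j.     *)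
Definition vergne ell W : {vspace g} :=
  (\sum_(1 <= j < (size W).+1) radical ell <<take j W>>)%VS.

End LieSubspaces.

(* Generators are numbered from 1: only Z 1, ..., Z m are meaningful in a      *)
(* family Z : nat -> g.                                                        *)
Section FreeStepTwo.
Variables (K : fieldType) (g : lieAlgType K).
Implicit Types (ell : 'Hom(g, K^o)) (Z : nat -> g) (m j k : nat).

Definition generators m Z : seq g := [seq Z i | i <- index_iota 1 m.+1].

(* The [Z_i, Z_k] with 1 <= i < k <= m. *)
Definition generator_brackets m Z : seq g :=
  [seq lie (Z i) (Z k) | i <- index_iota 1 m.+1, k <- index_iota i.+1 m.+1].

(* g is free nilpotent of step two on Z 1, ..., Z m: writing Z_ik for          *)
(* [Z_i, Z_k], the Z_ik and the Z_i together form a basis of g, and the only   *)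
(* nonzero brackets of basis vectors are the defining ones of the Z_ik (up to  *)
(* antisymmetry).                                                              *)
Definition free_nilpotent2 m Z : Prop :=
  basis_of fullv (generator_brackets m Z ++ generators m Z) /\
  forall c w, c \in generator_brackets m Z ->
    w \in generator_brackets m Z ++ generators m Z -> lie c w = 0.

Definition M0 ell Z j : 'M[K]_j :=
  \matrix_(a < j, b < j) ell (lie (Z a.+1) (Z b.+1)).

Definition vcol ell Z j : 'cV[K]_j.-1 :=
  \col_(a < j.-1) ell (lie (Z a.+1) (Z j)).

Definition mu Z k (z : 'cV[K]_k) : g := \sum_(a < k) z a 0 *: Z a.+1.

End FreeStepTwo.

(* Main.v *)
(** For [k >= 0], set [h_k := z + span (Z_1, ..., Z_k)], where [z] is the
    centre.  The ideals of the flag that lie inside [z] contribute only central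
    elements to the Vergne sum, and the others are [h_1, ..., h_m].  When
    [M0 k] is invertible the radical of [ell] on [h_k] is [z].  Any such
    invertible stage is followed by a stage [h_(k+1)] whose radical is
    [z + R w] with [w := Z_(k+1) - mu (M0 k ^-1 v)]: by the choice of [w],
    [ell [Z_a, w] = 0] for [a <= k], and [ell [Z_(k+1), w] = 0] follows from
    [[w, w] = 0]; conversely an element of the radical with [Z_(k+1)]-coordinate
    [r] differs from [r w] by an element of the radical on [h_k].  The generator
    [Z_1] is the case [k = 0]. *)

Require Import Defs.
From mathcomp Require Import all_boot all_order all_algebra.
From mathcomp Require Import reals.

Import GRing.Theory Num.Theory.
Local Open Scope ring_scope.

Section LieTheory.
Set Implicit Arguments.
Unset Strict Implicit.
Unset Printing Implicit Defensive.

Variables (K : fieldType) (g : lieAlgType K).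
Implicit Types (ell : 'Hom(g, K^o)) (Z : nat -> g) (C : seq g).

(** * Bracket identities and the centre *)

Lemma lieDl (x y z : g) : lie (x + y) z = lie x z + lie y z.
Proof. by have := lie_linearl z 1 x y; rewrite !scale1r. Qed.

Lemma lieC (x y : g) : lie x y = - lie y x.
Proof.
apply/eqP; rewrite -addr_eq0; apply/eqP.
by have := liexx (x + y); rewrite lieDl !linearD /= !liexx add0r addr0.
Qed.

Lemma lie_center_radical ell (h : {vspace g}) :
  (lie_center g <= h)%VS -> (lie_center g <= radical ell h)%VS.
Proof.
move=> zh; apply/subvP=> x zx; apply/radicalP; split; first exact: (subvP zh).
by move=> y _; rewrite lieC (lie_centerP _ zx) oppr0 linear0.
Qed.

(** * Spans of the first [k] generators *)

Lemma generatorsS k Z : generators k.+1 Z = rcons (generators k Z) (Z k.+1).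
Proof. rewrite -map_rcons /generators /index_iota !subn1; congr map.
by rewrite -cats1 -{2}add1n -(iotaD 1 k 1) addn1. Qed.

Lemma size_generators k Z : size (generators k Z) = k.
Proof. by rewrite size_map size_iota subn1. Qed.

Lemma take_generators k m Z : (k <= m)%N -> take k (generators m Z) = generators k Z.
Proof.
move=> km; rewrite /generators -map_take /index_iota !subn1 take_iota.
by rewrite (minn_idPl km).
Qed.

Lemma mem_generators k i Z : (0 < i <= k)%N -> Z i \in generators k Z.
Proof. by move=> ik; apply: map_f; rewrite mem_index_iota ltnS. Qed.

Lemma span_generatorsS k Z :
  (<<generators k.+1 Z>> = <<generators k Z>> + <[Z k.+1]>)%VS.
Proof. by rewrite generatorsS -cats1 span_cat span_seq1. Qed.

Lemma mu_span k Z (z : 'cV[K]_k) : mu Z z \in <<generators k Z>>%VS.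
Proof.
apply: memv_suml => a _; apply/memvZ/memv_span/mem_generators.
by rewrite ltn_ord.
Qed.

Lemma span_generatorsP k Z x :
  x \in <<generators k Z>>%VS -> exists z : 'cV[K]_k, x = mu Z z.
Proof.
(* Coefficients are taken as functions on [nat], so that the induction on [k] needs no casts between
   ordinals. *)
suff: x \in <<generators k Z>>%VS ->
    exists z : nat -> K, x = \sum_(a < k) z a *: Z a.+1.
  move=> coefs /coefs[z ->]; exists (\col_a z a).
  by apply: eq_bigr => a _; rewrite mxE.
elim: k x => [|k IH] x.
  by rewrite span_nil memv0 => /eqP->; exists (fun=> 0); rewrite big_ord0.
rewrite span_generatorsS => /memv_addP[_ /IH[z ->] [_ /vlineP[r ->] ->]].
exists (fun a => if a == k then r else z a).
rewrite big_ord_recr /= eqxx; congr (_ + _).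
by apply: eq_bigr => a _; rewrite (ltn_eqF (ltn_ord a)).
Qed.

(** * Radicals along the flag *)

Lemma M0_mulE ell k Z (z : 'cV[K]_k) (a : 'I_k) :
  (M0 ell Z k *m z) a 0 = ell (lie (Z a.+1) (mu Z z)).
Proof.
rewrite mxE !linear_sum; apply: eq_bigr => b _.
by rewrite mxE !linearZ mulrC.
Qed.

(** Central elements bracket to zero, so by linearity it suffices to test against the generators. *)
Lemma radical_generatorsP ell k Z x :
  reflect (x \in (lie_center g + <<generators k Z>>)%VS /\
           forall i, (0 < i <= k)%N -> ell (lie (Z i) x) = 0)
          (x \in radical ell (lie_center g + <<generators k Z>>)%VS).
Proof.
apply: (iffP (radicalP _ _ _)) => -[hx x0]; split=> // y.
  move=> yk; apply: x0; apply: (subvP (addvSr _ _)).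
  exact/memv_span/mem_generators.
case/memv_addP=> c zc [_ /span_generatorsP[z ->] ->].
rewrite lieDl (lie_centerP _ zc) add0r lieC linear_sum linearN linear_sum /=.
rewrite big1 ?oppr0 // => a _; rewrite 2!linearZ /= lieC linearN /= x0 ?ltn_ord //.
by rewrite oppr0 scaler0.
Qed.

(** Modulo the centre, an element of the radical is [mu Z z] with [M0 ell Z k *m z = 0]. *)
Lemma radical_unit ell k Z :
  M0 ell Z k \in unitmx ->
  radical ell (lie_center g + <<generators k Z>>)%VS = lie_center g.
Proof.
move=> uM; apply/eqP; rewrite eqEsubv lie_center_radical ?addvSl // andbT.
apply/subvP=> x /radical_generatorsP[].
case/memv_addP=> c zc [_ /span_generatorsP[z ->] ->] x0.
suff z0: z = 0 by rewrite z0 /mu big1 ?addr0 // => a _; rewrite mxE scale0r.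
rewrite -[z](mulKmx uM).
suff -> : M0 ell Z k *m z = 0 by rewrite mulmx0.
apply/matrixP=> a b; rewrite ord1 M0_mulE mxE -[RHS](x0 a.+1) ?ltn_ord //.
by rewrite linearD /= (lieC _ c) (lie_centerP _ zc) oppr0 add0r.
Qed.

Lemma radical_unitS ell k Z :
  M0 ell Z k \in unitmx ->
  radical ell (lie_center g + <<generators k.+1 Z>>)%VS =
    (lie_center g + <[Z k.+1 - mu Z (invmx (M0 ell Z k) *m vcol ell Z k.+1)]>)%VS.
Proof.
move=> uM; set u := invmx _ *m _; set w := _ - _.
(* These equations are the rows of [M0 ell Z k *m u = vcol ell Z k.+1]. *)
have w0 i : (0 < i <= k)%N -> ell (lie (Z i) w) = 0.
  case: i => // i ik; rewrite !linearB /= -(M0_mulE ell Z u (Ordinal ik)).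
  by rewrite mulKVmx // mxE subrr.
have ww0 : ell (lie (Z k.+1) w) = 0.
  have -> : Z k.+1 = w + mu Z u by rewrite subrK.
  rewrite lieDl liexx add0r lieC linear_sum linearN linear_sum /=.
  rewrite big1 ?oppr0 // => a _; rewrite 2!linearZ /= lieC linearN /= w0 ?ltn_ord //.
  by rewrite oppr0 scaler0.
apply/eqP; rewrite eqEsubv subv_add lie_center_radical ?addvSl //=.
apply/andP; split; last first.
  apply/radical_generatorsP; split=> [|i /andP[i0]]; last first.
    by rewrite leq_eqVlt => /predU1P[->|ik] //; apply: w0; rewrite i0.
  apply: (subvP (addvSr _ _)); rewrite span_generatorsS /w addrC.
  by apply: memv_add; rewrite ?memv_line // memvN mu_span.
apply/subvP=> x /radical_generatorsP[].
rewrite span_generatorsS => /memv_addP[c zc [_ /memv_addP[y hy [_ /vlineP[r ->] ->]] ->]].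
set x' := _ + _ => x0; rewrite -[x'](subrK (r *: w)).
apply: memv_add; last exact/memvZ/memv_line.
(* Subtracting [r *: w] cancels the [Z k.+1] term, which leaves an element of the radical on
   [h_k]. *)
rewrite -(radical_unit uM); apply/radical_generatorsP; split=> [|i ik].
  have -> : x' - r *: w = c + (y + r *: mu Z u).
    rewrite /x' /w scalerBr opprB -!addrA; congr (_ + (_ + _)).
    by rewrite addrC subrK.
  by apply: memv_add => //; apply: memvD => //; apply/memvZ/mu_span.
have /andP[i0 ilek] := ik.
by rewrite 2!linearB 2!linearZ /= x0 ?w0 ?i0 ?leqW // scaler0 subr0.
Qed.

(** * The centre of the free algebra *)

Definition bracket_indices m : seq (nat * nat) :=
  [seq (i, k) | i <- index_iota 1 m.+1, k <- index_iota i.+1 m.+1].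

(** Listing the brackets by index pairs allows a single one to be isolated by its indices, without
    comparing vectors. *)
Lemma generator_bracketsE m Z :
  generator_brackets m Z = [seq lie (Z p.1) (Z p.2) | p <- bracket_indices m].
Proof. by rewrite /bracket_indices map_allpairs. Qed.

Lemma mem_bracket_indices m i k :
  (0 < i)%N -> (i < k)%N -> (k <= m)%N -> (i, k) \in bracket_indices m.
Proof.
move=> i0 ik km; apply/allpairsPdep; exists i, k; split=> //.
  by rewrite mem_index_iota i0 ltnS (leq_trans (ltnW ik)).
by rewrite mem_index_iota ik.
Qed.

(** Up to sign, [[Z_j, Z_l]] with [l != j] is the basis bracket of the sorted pair of [j] and [l],
    and distinct [l] give distinct pairs. *)
Lemma lie_generator_notin_span m Z i j :
  free (generator_brackets m Z) -> (0 < i <= m)%N -> (0 < j <= m)%N -> i != j ->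
  lie (Z j) (Z i) \notin
    <<[seq lie (Z j) (Z l) | l <- index_iota 1 m.+1 & l != i]>>%VS.
Proof.
move=> free_brackets iP jP ij.
pose f (p : nat * nat) := lie (Z p.1) (Z p.2).
pose sorted_pair a b := (minn a b, maxn a b).
have fE (V : {vspace g}) a b : (lie (Z a) (Z b) \in V) = (f (sorted_pair a b) \in V).
  by rewrite /f /sorted_pair /=; case: leqP => // _; rewrite lieC memvN.
have sortedP a b : (0 < a <= m)%N -> (0 < b <= m)%N -> b != a ->
    sorted_pair a b \in bracket_indices m.
  move=> /andP[a0 am] /andP[b0 bm]; rewrite /sorted_pair.
  by case: ltngtP => // ab _; rewrite mem_bracket_indices.
move: free_brackets; rewrite generator_bracketsE.
have /(perm_map f)/perm_free-> := perm_to_rem (sortedP j i jP iP ij).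
rewrite /= free_cons -fE => /andP[+ _]; apply: contra.
apply/subvP/span_subvP=> _ /mapP[l + ->]; rewrite mem_filter mem_index_iota ltnS.
case/andP=> li lP; have [->|lj] := eqVneq l j; first by rewrite liexx mem0v.
rewrite fE; apply/memv_span/map_f; move: (sortedP j l jP lP lj).
rewrite (perm_mem (perm_to_rem (sortedP j i jP iP ij))) inE => /predU1P[] //.
(* Equal sorted pairs have equal sums, so [j + l = j + i], against [l != i]. *)
rewrite /sorted_pair => -[emin emax]; case/eqP: li; apply: (@addnI j).
by rewrite -(addn_min_max j l) emin emax addn_min_max.
Qed.

(** If a central [x] had a nonzero coordinate at some generator, bracketing [x] with a different
    generator [Z j] would express one bracket through the others, against
    [lie_generator_notin_span]. *)
Lemma lie_center_free m Z :
  (1 < m)%N -> free_nilpotent2 m Z ->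
  lie_center g = <<generator_brackets m Z>>%VS.
Proof.
move=> m1 [/andP[/eqP spanZ freeZ] brackets0].
have brackets_central : (<<generator_brackets m Z>> <= lie_center g)%VS.
  apply/span_subvP=> c Cc; apply/lie_centerP=> y.
  have By : y \in <<generator_brackets m Z ++ generators m Z>>%VS.
    by rewrite spanZ memvf.
  suff: y \in lker (linfun (lie c)) by rewrite memv_ker lfunE => /eqP.
  apply: (subvP _ _ By); apply/span_subvP=> w Bw.
  by rewrite memv_ker lfunE /= brackets0.
apply/eqP; rewrite eqEsubv brackets_central andbT.
apply/subvP=> x /lie_centerP zx.
have: x \in <<generator_brackets m Z ++ generators m Z>>%VS by rewrite spanZ memvf.
rewrite span_cat => /memv_addP[c cC [_ /span_generatorsP[z ->] xE]].
suff z0: z = 0.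
  by rewrite xE z0 /mu big1 ?addr0 // => a _; rewrite mxE scale0r.
apply/matrixP=> i b; rewrite ord1 mxE; apply: contraTeq isT => zi0.
(* The ordinal [i] stands for [Z i.+1]: [j = 2] serves for [Z 1] and is available since [1 < m];
   otherwise [j = 1]. *)
have [j [jP ij]] : exists j : nat, (0 < j <= m)%N /\ i.+1 != j.
  by exists (if i == 0 :> nat then 2 else 1)%N;
    case: eqP => [->|/eqP]; rewrite ?m1 ?(ltnW m1).
have iP : (0 < i.+1 <= m)%N by rewrite ltn_ord.
have := lie_generator_notin_span (catl_free freeZ) iP jP ij.
suff -> : lie (Z j) (Z i.+1) = - (z i 0)^-1 *:
    \sum_(a < m | a != i) z a 0 *: lie (Z j) (Z a.+1).
  rewrite memvZ // memv_suml // => a ai; apply/memvZ/memv_span.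
  apply: (map_f (fun l => lie (Z j) (Z l))).
  by rewrite mem_filter mem_index_iota eqSS ai !ltnS /= ltn_ord.
have: lie (Z j) x = 0 by rewrite lieC zx oppr0.
have cz : lie (Z j) c = 0.
  by rewrite lieC (lie_centerP _ (subvP brackets_central _ cC)) oppr0.
rewrite xE linearD /= cz add0r linear_sum (bigD1 i) //= linearZ /=.
move/eqP; rewrite addr_eq0 => /eqP zE.
rewrite scaleNr -scalerN; apply: (scalerI zi0); rewrite scalerA divff // scale1r zE.
by congr (- _); apply: eq_bigr => a _; rewrite linearZ.
Qed.

(** * The Vergne sum *)

(** Both parities are treated at once: [uphalf m] counts the odd indices [2 * k + 1 <= m], with
    [Z 1] at [k = 0]. *)
Lemma vergne_free m Z C ell :
  (1 < m)%N -> free_nilpotent2 m Z -> perm_eq C (generator_brackets m Z) ->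
  (forall k, (2 <= k <= m)%N -> ~~ odd k -> \det (M0 ell Z k) != 0) ->
  vergne ell (C ++ generators m Z) =
    (lie_center g + \sum_(0 <= k < uphalf m)
       <[Z (2 * k).+1 -
         mu Z (invmx (M0 ell Z (2 * k)) *m vcol ell Z (2 * k).+1)]>)%VS.
Proof.
move=> m1 freeZ eqC det_neq0.
have spanC : <<C>>%VS = lie_center g.
  by rewrite (lie_center_free m1 freeZ); apply/eq_span/perm_mem.
have unit_M0 k : (2 * k <= m)%N -> M0 ell Z (2 * k) \in unitmx.
  (* The hypothesis starts at size 2; the empty matrix has determinant 1. *)
  rewrite unitmxE unitfE; case: k => [|k] km; first by rewrite det_mx00 oner_neq0.
  by apply: det_neq0; rewrite ?km ?andbT ?mul2n ?odd_double.
have span_take k : (k <= m)%N ->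
    <<take (size C + k) (C ++ generators m Z)>>%VS =
    (lie_center g + <<generators k Z>>)%VS.
  move=> km; rewrite takeD take_size_cat // drop_size_cat //.
  by rewrite take_generators // span_cat spanC.
rewrite /vergne big_add1 size_cat size_generators !big_mkord /=.
apply/eqP; rewrite eqEsubv; apply/andP; split.
  apply/subv_sumP=> j _; have [jC|Cj] := leqP j.+1 (size C).
    rewrite takel_cat //; apply: subv_trans (capvSl _ _) _.
    apply: subv_trans (addvSl _ _); rewrite -spanC; apply: sub_span.
    by move=> x; apply: mem_take.
  have [k km ->] : exists2 k, (k < m)%N & j.+1 = (size C + k.+1)%N.
    exists (j - size C)%N; last by rewrite addnS subnKC.
    by rewrite ltn_subLR.
  (* For odd [k], [M0] of size [k.+1] is itself invertible; for even [k], the stage follows the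
     invertible one of size [k]. *)
  rewrite span_take //; have [odd_k|even_k] := boolP (odd k).
    rewrite -[k.+1]odd_double_half /= odd_k -mul2n add0n radical_unit ?addvSl //.
    apply: unit_M0; move: km; rewrite -[k.+1 in X in X -> _]odd_double_half /=.
    by rewrite odd_k mul2n.
  have kE : k = (2 * k./2)%N by rewrite mul2n -[LHS]odd_double_half (negPf even_k).
  have k2m : (k./2 < uphalf m)%N.
    by rewrite gtn_uphalf_double -mul2n -kE.
  rewrite kE radical_unitS; last by apply: unit_M0; rewrite -kE ltnW.
  by apply: addvS => //; apply: (sumv_sup (Ordinal k2m)).
rewrite subv_add; apply/andP; split.
  (* The centre is found in the last stage, the radical on the whole algebra. *)
  have mlast : ((size C + m).-1 < size C + m)%N.
    by rewrite prednK // addn_gt0 (ltnW m1) orbT.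
  apply: (sumv_sup (Ordinal mlast)) => //=.
  rewrite prednK ?(leq_ltn_trans _ mlast) // span_take //.
  by rewrite lie_center_radical ?addvSl.
apply/subv_sumP=> k _.
have km : (2 * k < m)%N by rewrite mul2n -gtn_uphalf_double.
(* The summation index is shifted by one, so this index denotes the ideal [h_(2k+1)]. *)
have jm : (size C + 2 * k < size C + m)%N by rewrite ltn_add2l.
apply: (sumv_sup (Ordinal jm)) => //=.
rewrite -addnS span_take // radical_unitS ?addvSr //.
exact/unit_M0/ltnW.
Qed.

End LieTheory.

Theorem proposition7 (R : realType) (m : nat) (g : lieAlgType R)
    (Z : nat -> g) (C : seq g) (ell : 'Hom(g, R^o)) :
  (1 < m)%N ->
  free_nilpotent2 m Z ->
  perm_eq C (generator_brackets m Z) ->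
  (forall k : nat, (2 <= k <= m)%N -> ~~ odd k -> \det (M0 ell Z k) != 0) ->
  (forall s : nat, m = (2 * s).+1 ->
    vergne ell (C ++ generators m Z) =
      (lie_center g + <[Z 1%N]> +
       \sum_(1 <= k < s.+1)
         <[Z (2 * k).+1 -
           mu Z (invmx (M0 ell Z (2 * k)) *m vcol ell Z (2 * k).+1)]>)%VS) /\
  (forall s : nat, m = (2 * s)%N ->
    vergne ell (C ++ generators m Z) =
      (lie_center g + <[Z 1%N]> +
       \sum_(1 <= k < s)
         <[Z (2 * k).+1 -
           mu Z (invmx (M0 ell Z (2 * k)) *m vcol ell Z (2 * k).+1)]>)%VS).
Proof.
move=> m1 freeZ eqC det_neq0.
have vergneE := vergne_free m1 freeZ eqC det_neq0.
(* At [k = 0] the correction vanishes, so the first summand becomes the line of [Z 1]. *)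
have mu0 (z : 'cV[R]_0) : mu Z z = 0 by rewrite /mu big_ord0.
split=> s ms; rewrite vergneE.
  rewrite [uphalf m](_ : _ = s.+1); last by rewrite ms mul2n /= doubleK.
  by rewrite big_ltn // addvA mu0 subr0.
rewrite [uphalf m](_ : _ = s); last by rewrite ms mul2n uphalf_double.
have s0 : (0 < s)%N by case: s ms m1 => // ->.
by rewrite big_ltn // addvA mu0 subr0.
Qed.
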